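(* Consider the constrained Markov decision process and the linear programs (P) and (P$^*$) described in the context. Let $\{(\rho_n,h_n,\beta_n)\}_{n\ge0}$ be a maximizing sequence of the dual program (P$^*$), and let $h^*=\limsup_{n\to\infty}h_n$ (pointwise). Suppose that: (i) a stationary optimal pair $(\mu^*,p^* )$ exists and $\inf(\mathrm{P})=\sup(\mathrm{P}^* )=\rho_c^*<+\infty$; (ii) the functions $h_n$ satisfy $$\int_{\mathbb{X}}|h^*|\,dp^*<+\infty,\qquad \int_{\mathbb{X}}\sup_{n\ge0}|h_n(y)|\,q(dy\,|\,x,a)<+\infty\quad\forall\,(x,a)\in\Gamma;$$ (iii) the sequence $\{\beta_n\}$ converges to some finite $\beta^*=(\beta^*_1,\ldots,\beta^*_d)$. Then $h^*$ is finite everywhere and, with $$c^*(x,a):=c_0(x,a)-\sum_{i=1}^d\beta_i^*c_i(x,a),\qquad \tilde\rho^*:=\rho_c^*-\sum_{i=1}^d\beta_i^*\kappa_i,$$ we have $$\tilde\rho^*+h^*(x)\le c^*(x,a)+\int_{\mathbb{X}}h^*(y)\,q(dy\,|\,x,a)\qquad\forall\,(x,a)\in\Gamma,$$ and for $p^*$-almost all $x\in\mathbb{X}$, $$\tilde\rho^*+h^*(x)=\inf_{a\in A(x)}\Big\{c^*(x,a)+\int_{\mathbb{X}}h^*(y)\,q(dy\,|\,x,a)\Big\}=\int_{A(x)}\Big\{c^*(x,a)+\int_{\mathbb{X}}h^*(y)\,q(dy\,|\,x,a)\Big\}\,\mu^*(da\,|\,x).$$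
   Context: MDP model. $\mathbb{X}$ (state space) is a Borel space, i.e., a separable metrizable space homeomorphic to a Borel subset of a Polish space. $\mathbb{A}$ (action space) is a countable set with the discrete topology. For a topological space $X$, $\mathcal{B}(X)$ is its Borel $\sigma$-algebra and $\mathcal{P}(X)$ the set of Borel probability measures; for $X$ a Borel space, $\mathcal{P}(X)$ carries the topology of weak convergence. Each $x\in\mathbb{X}$ has a nonempty set $A(x)\subset\mathbb{A}$ of admissible actions, and $\Gamma=\{(x,a): x\in\mathbb{X}, a\in A(x)\}$ is a Borel subset of $\mathbb{X}\times\mathbb{A}$. The state transition kernel $q(dy\,|\,x,a)$ is a Borel measurable stochastic kernel on $\mathbb{X}$ given $\mathbb{X}\times\mathbb{A}$. The one-stage cost functions $c_0,c_1,\ldots,c_d:\mathbb{X}\times\mathbb{A}\to[0,+\infty]$ are Borel measurable, finite on $\Gamma$ and equal to $+\infty$ outside $\Gamma$; their restrictions to $\Gamma$ are denoted by the same symbols. $\kappa=(\kappa_1,\ldots,\kappa_d)\ge0$ is a given vector of upper limits in $\mathbb{R}^d$. Policies and average costs. A policy is a sequence $\pi=(\mu_0,\mu_1,\ldots)$ where $\mu_n(da_n\,|\,x_0,a_0,\ldots,a_{n-1},x_n)$ is a Borel measurable stochastic kernel on $\mathbb{A}$ given $(\mathbb{X}\times\mathbb{A})^n\times\mathbb{X}$ with $\mu_n(A(x_n)\,|\,x_0,a_0,\ldots,a_{n-1},x_n)=1$ everywhere; $\Pi$ is the set of all policies. A stationary policy is one of the form $(\mu,\mu,\ldots)$ with $\mu(da\,|\,x)$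 a Borel measurable stochastic kernel on $\mathbb{A}$ given $\mathbb{X}$ with $\mu(A(x)\,|\,x)=1$; it is denoted by $\mu$. A policy $\pi$ and an initial distribution $\zeta\in\mathcal{P}(\mathbb{X})$, together with $q$, determine the law of the process $\{(x_n,a_n)\}_{n\ge0}$, with expectation $\mathbf{E}^\pi_\zeta$. For $0\le i\le d$, $J_i(\pi,\zeta)=\limsup_{n\to\infty} n^{-1}\mathbf{E}^\pi_\zeta\big[\sum_{k=0}^{n-1}c_i(x_k,a_k)\big]$. Constrained problem. The feasible set is $\mathcal{S}=\{(\pi,\zeta)\in\Pi\times\mathcal{P}(\mathbb{X}): J_0(\pi,\zeta)<\infty,\ J_i(\pi,\zeta)\le\kappa_i,\ i=1,\ldots,d\}$, and $\rho_c^*=\inf_{(\pi,\zeta)\in\mathcal{S}}J_0(\pi,\zeta)$. A stationary optimal pair is a pair $(\mu^*,p^* )\in\mathcal{S}$ with $J_0(\mu^*,p^* )=\rho_c^*$ such that $\mu^*$ is a stationary policy and $p^*$ is an invariant probability measure of the Markov chain on $\mathbb{X}$ induced by $\mu^*$, i.e., $p^*(B)=\int_{\mathbb{X}}\int_{\mathbb{A}}q(B\,|\,x,a)\,\mu^*(da\,|\,x)\,p^*(dx)$ for all $B\in\mathcal{B}(\mathbb{X})$. Linear programs. Let $w(x,a)=1+\sup_{0\le i\le d}c_i(x,a)$ on $\Gamma$. $\mathbb{M}^+_w(\Gamma)$ is the set of finite nonnegative Borel measures $\gamma$ on $\Gamma$ with $\int w\,d\gamma<\infty$. $\mathbb{F}_b(\mathbb{X})$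 is the set of bounded real-valued Borel measurable functions on $\mathbb{X}$. $\hat\gamma$ is the marginal of $\gamma$ on $\mathbb{X}$, and $\langle\gamma,c_i\rangle=\int_\Gamma c_i\,d\gamma$. Vector inequalities are componentwise. (P): minimize $\langle\gamma,c_0\rangle$ over $\gamma\in\mathbb{M}_w^+(\Gamma)$ and $\alpha\in\mathbb{R}^d$, $\alpha\ge0$, subject to $\gamma(\Gamma)=1$; $\hat\gamma(B)=\int_\Gamma q(B\,|\,x,a)\,\gamma(d(x,a))$ for all $B\in\mathcal{B}(\mathbb{X})$; and $\big(\langle\gamma,c_1\rangle,\ldots,\langle\gamma,c_d\rangle\big)+\alpha=\kappa$. (P$^*$): maximize $\rho+\sum_{i=1}^d\beta_i\kappa_i$ over $(\rho,h,\beta)\in\mathbb{R}\times\mathbb{F}_b(\mathbb{X})\times\mathbb{R}^d$ subject to $\rho+h(x)-\int_{\mathbb{X}}h(y)\,q(dy\,|\,x,a)+\sum_{i=1}^d\beta_ic_i(x,a)\le c_0(x,a)$ for all $(x,a)\in\Gamma$, and $\beta\le0$. $\inf(\mathrm{P})$ and $\sup(\mathrm{P}^* )$ denote the optimal values. A maximizing sequence of (P$^*$) is a sequence $\{(\rho_n,h_n,\beta_n)\}$ of feasible solutions of (P$^*$) with $\rho_n+\sum_{i=1}^d\beta_{n,i}\kappa_i\uparrow\sup(\mathrm{P}^* )$, where $\beta_{n,i}$ is the $i$th component of $\beta_n$.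
   Formalization: ''h* is finite everywhere'' fails as stated (h_n may tend to −∞ at a state no transition reaches), so it is replaced by: h* < +∞ everywhere, and h* is finite p*-almost everywhere and q(·|x,a)-almost everywhere for every (x,a) in Γ. *)

(* Defs.v *)
From HB Require Import structures.
From mathcomp Require Import all_boot all_order all_algebra.
From mathcomp Require Import all_classical all_reals all_analysis.
From mathcomp Require Import measurable_realfun.

Set Implicit Arguments.
Unset Strict Implicit.
Unset Printing Implicit Defensive.
Import Order.TTheory GRing.Theory Num.Theory.
Import numFieldNormedType.Exports.

Local Open Scope classical_set_scope.
Local Open Scope ring_scope.
Local Open Scope ereal_scope.

(* A topological space seen as a measurable space with its Borel
   sigma-algebra. *)
Notation borel T := (g_sigma_algebraType (@open T)).

(* Polish: separable and metrizable by a complete metric (a pseudometric whose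
   topology is Hausdorff is a metric). *)
Definition polish (R : realType) (P : completePseudoMetricType R) : Prop :=
  hausdorff_space P /\ exists2 D : set P, countable D & dense D.

(* Homeomorphic to a Borel subset of a Polish space; f is a homeomorphism onto
   its range. Such a space is automatically separable and metrizable. *)
Definition borel_space (R : realType) (X : ptopologicalType) : Prop :=
  exists (P : completePseudoMetricType R) (f : X -> P),
    [/\ polish P,
        injective f,
        (forall U : set X, open U <-> exists2 V : set P, open V & U = f @^-1` V)
      & (measurable : set (set (borel P))) (range f)].

Section composition_product.
Context d1 d2 (S : measurableType d1) (T : measurableType d2) (R : realType).
Variables (m : probability S R) (k : R.-pker S ~> T).

(* The joint law of (s, t) when s ~ m and t ~ k s. *)
Definition compprod (U : set (S * T)) : \bar R :=
  \int[m]_s k s (xsection U s).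

Lemma measurable_compprod_fun (U : set (S * T)) : measurable U ->
  measurable_fun [set: S] (fun s => k s (xsection U s)).
Proof.
move=> mU; rewrite -kfcompkindic//; apply: measurable_kfcomp.
  by apply/measurable_EFinP; exact: measurable_indic.
by move=> t /=; rewrite lee_fin.
Qed.

Let compprod0 : compprod set0 = 0.
Proof. by apply: integral0_eq => s _; rewrite xsection0 measure0. Qed.

Let compprod_ge0 U : 0 <= compprod U.
Proof. exact: integral_ge0. Qed.

Let compprod_sigma_additive : semi_sigma_additive compprod.
Proof.
move=> F mF tF mUF.
rewrite [X in _ --> X](_ : _ = \sum_(0 <= i <oo) compprod (F i)); last first.
  rewrite /compprod -integral_nneseries//; last first.
    by move=> n; exact: measurable_compprod_fun.
  apply: eq_integral => s _; rewrite xsection_bigcup measure_semi_bigcup//.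
  - by move=> n; exact: measurable_xsection.
  - exact: trivIset_xsection.
  - by apply: bigcup_measurable => n _; exact: measurable_xsection.
by apply: is_cvg_nneseries => n _ _; exact: compprod_ge0.
Qed.

HB.instance Definition _ := isMeasure.Build _ _ R compprod
  compprod0 compprod_ge0 compprod_sigma_additive.

Let compprod_setT : compprod [set: S * T] = 1.
Proof.
rewrite /compprod -[RHS](@probability_setT _ _ _ m).
rewrite (eq_integral (cst 1)) ?integral_cst ?mul1e// => s _.
rewrite (_ : xsection _ _ = setT) ?prob_kernel//.
by apply/seteqP; split => // t _; rewrite /xsection/= inE.
Qed.

HB.instance Definition _ := Measure_isProbability.Build _ _ R compprod
  compprod_setT.

End composition_product.

Section kernel_precomposition.
Context d1 d2 d3 (S : measurableType d1) (T : measurableType d2)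
  (V : measurableType d3) (R : realType).
Variables (k : R.-pker T ~> V) (f : S -> T).

Definition kprecomp (mf : measurable_fun [set: S] f) :
  S -> {measure set V -> \bar R} := fun s => k (f s).

Hypothesis mf : measurable_fun [set: S] f.

Let measurable_kprecomp U : measurable U ->
  measurable_fun [set: S] (kprecomp mf ^~ U).
Proof.
move=> mU; apply: (@measurableT_comp _ _ _ _ _ _ (k ^~ U)) => //.
exact: measurable_kernel.
Qed.

HB.instance Definition _ := isKernel.Build _ _ _ _ _ (kprecomp mf)
  measurable_kprecomp.

Let kprecomp_prob s : kprecomp mf s [set: V] = 1.
Proof. exact: prob_kernel. Qed.

HB.instance Definition _ := Kernel_isProbability.Build _ _ _ _ _
  (kprecomp mf) kprecomp_prob.

End kernel_precomposition.

Section histories.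
Context (X A : ptopologicalType).

(* hist n is the space of sequences (x_0, a_0, ..., a_(n-1), x_n), i.e.
   X * (A * X)^n associated to the left. *)
Fixpoint hist_display (n : nat) : measure_display :=
  if n isn't n'.+1 then sigma_display (@open X)
  else measure_prod_display
         (measure_prod_display (hist_display n', sigma_display (@open A)),
          sigma_display (@open X)).

Fixpoint hist (n : nat) : measurableType (hist_display n) :=
  match n return measurableType (hist_display n) with
  | 0 => borel X
  | n'.+1 => (hist n' * borel A * borel X)%type
  end.

Definition hist_state (n : nat) : hist n -> borel X :=
  match n return hist n -> borel X with
  | 0 => id
  | n'.+1 => snd
  end.

Lemma measurable_hist_state n : measurable_fun [set: hist n] (@hist_state n).
Proof. by case: n => [|n]; [exact: measurable_id|exact: measurable_snd]. Qed.

Lemma measurable_hist_state_action n :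
  measurable_fun [set: hist n * borel A]
    (fun ha => (hist_state ha.1, ha.2) : borel X * borel A).
Proof.
apply/measurable_fun_pairP; split; last exact: measurable_snd.
exact: measurableT_comp (@measurable_hist_state n) measurable_fst.
Qed.

(* \sum_(k < n) c (x_k, a_k) *)
Fixpoint total_cost (R : realType) (c : X * A -> \bar R) (n : nat) :
    hist n -> \bar R :=
  match n return hist n -> \bar R with
  | 0 => fun=> 0
  | n'.+1 => fun h => total_cost c h.1.1 + c (hist_state h.1.1, h.1.2)
  end.

End histories.

Record mdp (R : realType) (X : ptopologicalType) (A : pdiscreteTopologicalType)
    (d : nat) := Mdp {
  adm : X -> set A ;
  adm_nonempty : forall x, adm x !=set0 ;
  adm_measurable :
    measurable ([set xa | adm xa.1 xa.2] : set (borel X * borel A)) ;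
  trans : R.-pker (borel X * borel A) ~> borel X ;
  cost : 'I_d.+1 -> X * A -> \bar R ;
  cost_ge0 : forall i xa, 0 <= cost i xa ;
  cost_measurable : forall i,
    measurable_fun [set: borel X * borel A] (cost i) ;
  cost_fin : forall i xa, adm xa.1 xa.2 -> cost i xa < +oo ;
  cost_out : forall i xa, ~ adm xa.1 xa.2 -> cost i xa = +oo ;
  kappa : 'rV[R]_d ;
  kappa_ge0 : forall i, (0 <= kappa 0 i)%R }.

Section constrained_mdp.
Context (R : realType) (X : ptopologicalType) (A : pdiscreteTopologicalType)
  (d : nat) (M : mdp R X A d).

Definition Gam : set (borel X * borel A) := [set xa | adm M xa.1 xa.2].

(* c_i for 1 <= i <= d, with i shifted to 'I_d *)
Definition ccost (i : 'I_d) : X * A -> \bar R := cost M (lift ord0 i).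

Record policy := Policy {
  policy_kernel :> forall n, R.-pker (hist X A n) ~> borel A ;
  policy_adm : forall n (h : hist X A n),
    policy_kernel n h (adm M (hist_state h)) = 1 }.

Record stationary_policy := StationaryPolicy {
  stationary_kernel :> R.-pker (borel X) ~> borel A ;
  stationary_adm : forall x, stationary_kernel x (adm M x) = 1 }.

Definition policy_of_stationary (mu : stationary_policy) : policy :=
  @Policy
    (fun n => kprecomp mu (@measurable_hist_state X A n) : R.-pker _ ~> _)
    (fun n h => stationary_adm mu (hist_state h)).

(* The law of (x_0, a_0, ..., a_(n-1), x_n) under the policy pi when
   x_0 ~ zeta. *)
Fixpoint law (pi : policy) (zeta : probability (borel X) R) (n : nat) :
    probability (hist X A n) R :=
  match n return probability (hist X A n) R with
  | 0 => zeta
  | n'.+1 => compprod (compprod (law pi zeta n') (pi n') : probability _ R)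
      (kprecomp (trans M) (@measurable_hist_state_action X A n')
        : R.-pker _ ~> _)
  end.

(* The value at n = 0 is 0 and does not affect the limit superior. *)
Definition avg_cost (i : 'I_d.+1) (pi : policy)
    (zeta : probability (borel X) R) : \bar R :=
  limn_esup (fun n => (n%:R^-1)%:E *
    \int[law pi zeta n]_h total_cost (cost M i) h).

Definition mdp_feasible (pi : policy) (zeta : probability (borel X) R) : Prop :=
  avg_cost ord0 pi zeta < +oo /\
  forall i : 'I_d, avg_cost (lift ord0 i) pi zeta <= (kappa M 0 i)%:E.

Definition rho_c : \bar R :=
  ereal_inf [set v | exists pi zeta,
    mdp_feasible pi zeta /\ v = avg_cost ord0 pi zeta].

Definition invariant (mu : stationary_policy) (p : probability (borel X) R) :
    Prop :=
  forall B : set (borel X), measurable B ->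
    p B = \int[p]_x \int[mu x]_a trans M (x, a) B.

Definition stationary_optimal_pair (mu : stationary_policy)
    (p : probability (borel X) R) : Prop :=
  [/\ mdp_feasible (policy_of_stationary mu) p,
      avg_cost ord0 (policy_of_stationary mu) p = rho_c
    & invariant mu p].

Definition weight (xa : X * A) : \bar R :=
  1 + ereal_sup [set cost M i xa | i in [set: 'I_d.+1]].

(* A measure on Gam is represented by a measure on X * A that gives mass 0 to
   the complement of Gam. *)
Definition primal_feasible
    (gamma : {finite_measure set (borel X * borel A)%type -> \bar R})
    (alpha : 'rV[R]_d) : Prop :=
  [/\ gamma (~` Gam) = 0 /\ \int[gamma]_(xa in Gam) weight xa < +oo,
      (forall i, (0 <= alpha 0 i)%R),
      gamma Gam = 1,
      (forall B : set (borel X), measurable B ->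
        pushforward gamma fst B = \int[gamma]_(xa in Gam) trans M xa B)
    & (forall i, \int[gamma]_(xa in Gam) ccost i xa + (alpha 0 i)%:E =
        (kappa M 0 i)%:E)].

Definition primal_value : \bar R :=
  ereal_inf [set v | exists gamma alpha, primal_feasible gamma alpha /\
    v = \int[gamma]_(xa in Gam) cost M ord0 xa].

Definition dual_feasible (rho : R) (h : X -> R) (beta : 'rV[R]_d) : Prop :=
  [/\ measurable_fun [set: borel X] h,
      (exists C : R, forall x, `|h x| <= C)%R,
      (forall xa : borel X * borel A, Gam xa ->
        (rho + h xa.1)%:E - \int[trans M xa]_y (h y)%:E
          + \sum_(i < d) (beta 0 i)%:E * ccost i xa
        <= cost M ord0 xa)
    & (forall i, (beta 0 i <= 0)%R)].

Definition dual_obj (rho : R) (beta : 'rV[R]_d) : R :=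
  (rho + \sum_(i < d) beta 0 i * kappa M 0 i)%R.

Definition dual_value : \bar R :=
  ereal_sup [set v | exists rho h beta, dual_feasible rho h beta /\
    v = (dual_obj rho beta)%:E].

Definition maximizing_sequence (rho : nat -> R) (h : nat -> X -> R)
    (beta : nat -> 'rV[R]_d) : Prop :=
  [/\ (forall n, dual_feasible (rho n) (h n) (beta n)),
      nondecreasing_seq (fun n => dual_obj (rho n) (beta n))
    & (dual_obj (rho n) (beta n))%:E @[n --> \oo] --> dual_value].

(* The value -oo cannot be excluded for a maximizing sequence: dual feasibility
   allows h n x --> -oo at a state x that no transition reaches. *)
Definition limsup_fun (h : nat -> X -> R) (x : X) : \bar R :=
  limn_esup (fun n => (h n x)%:E).

(* c^* *)
Definition lagrangian_cost (betas : 'rV[R]_d) (xa : X * A) : \bar R :=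
  cost M ord0 xa - \sum_(i < d) (betas 0 i)%:E * ccost i xa.

(* \tilde\rho^* *)
Definition lagrangian_value (betas : 'rV[R]_d) : \bar R :=
  rho_c - (\sum_(i < d) betas 0 i * kappa M 0 i)%:E.

End constrained_mdp.

(* Main.v *)
Require Import Defs.
From mathcomp Require Import all_boot all_order all_algebra.
From mathcomp Require Import all_classical all_reals all_analysis.
From mathcomp Require Import measurable_realfun.
From mathcomp Require Import lra.
Import Order.TTheory GRing.Theory Num.Theory.
Import numFieldNormedType.Exports.
Local Open Scope classical_set_scope.
Local Open Scope ring_scope.
Local Open Scope ereal_scope.

(** The theorem is complementary slackness between the maximizing dual
    sequence and the occupation measure [P(d(x,a)) = mu(da|x) p(dx)] of the
    stationary optimal pair.

    The inequality: dual feasibility of [(rho_n, h_n, beta_n)] at [(x, a)]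
    bounds [h_n x] by [c_0 - sum_i beta_n,i c_i - rho_n] plus the integral of
    [h_n] under [q(.|x,a)].  Strong duality and the convergence of [beta_n] make
    [rho_n] converge to the Lagrangian value.  The integral of [h_n] is at most
    that of [sup_(k >= n) h_k], which decreases to [h^*]; as [sup_n |h_n|] is
    integrable under [q(.|x,a)], dominated convergence gives the limit
    ([dominated_limn_esup]), and the limit superior of both sides is the claim
    ([optimality_inequality]).  The bound is finite, so [h^* x < +oo].

    The equality: since [p] is invariant, every [(x_k, a_k)] has law [P], so the
    average costs of the pair are integrals against [P]
    ([avg_cost_stationary]), and integrating [h^*] along one transition from [P]
    gives back its [p]-integral ([integral_invariant]).  Hence the right side of
    the inequality has [P]-integral
    [J_0 - sum_i beta^*_i J_i + int h^* dp].  As [beta^* <= 0], [J_i <= kappa_i]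
    and [J_0] is optimal, this is at most the [P]-integral of the left side.
    Two integrable functions ordered one way whose integrals are ordered the
    other way agree almost everywhere ([ae_occupation_optimality]).
    Disintegrating [P], for [p]-almost every [x] the equality holds for
    [mu(.|x)]-almost every [a]: some admissible action attains the infimum, and
    averaging over [mu(.|x)] leaves the constant left side. *)

Set Implicit Arguments.
Unset Strict Implicit.

(** * Integration against a composed law *)

Section compprod_integral.
Context {d1 d2} {S : measurableType d1} {T : measurableType d2} {R : realType}.
Variables (m : probability S R) (k : R.-pker S ~> T).

Let integral_compprod_indic (E : set (S * T)) : measurable E ->
  \int[compprod m k]_z (\1_E z)%:E = \int[m]_s \int[k s]_t (\1_E (s, t))%:E.
Proof.
move=> mE; rewrite integral_indic//= setIT /compprod.
apply: eq_integral => s _.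
by rewrite -[LHS](congr1 (@^~ s) (kfcompkindic k mE)).
Qed.

Import HBNNSimple.

Let integral_compprod_nnsfun (f : {nnsfun (S * T) >-> R}) :
  \int[compprod m k]_z (f z)%:E = \int[m]_s \int[k s]_t (f (s, t))%:E.
Proof.
have mf r : measurable (f @^-1` [set r]) by [].
have mfi r : measurable_fun setT
    (fun z => (r * \1_(f @^-1` [set r]) z)%:E : \bar R).
  by apply/measurable_EFinP; exact: measurable_funM.
under eq_integral do rewrite fimfunE -fsumEFin//.
rewrite ge0_integral_fsum//; last by move=> r z _; rewrite nnfun_muleindic_ge0.
under [RHS]eq_integral => s _.
  under eq_integral do rewrite fimfunE -fsumEFin//.
  rewrite ge0_integral_fsum//; last 2 first.
  - by move=> r; apply: measurableT_comp (mfi r) _.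
  - by move=> r z _; rewrite nnfun_muleindic_ge0.
  over.
rewrite [RHS]ge0_integral_fsum//; last 2 first.
- move=> r; have [r0|r0] := leP 0%R r.
    apply: (measurable_kfcomp k (mfi r)) => z.
    by rewrite lee_fin mulr_ge0.
  rewrite [X in measurable_fun _ X](_ : _ = cst 0); first by [].
  apply/funext => s /=; rewrite integral0_eq// => t _.
  by rewrite preimage_nnfun0// indic0 mulr0.
- move=> r s _; apply: integral_ge0 => t _; exact: nnfun_muleindic_ge0.
apply: eq_fsbigr => r _.
(* A negative [r] is not a value of [f], so its level set contributes 0. *)
have [r0|r0] := leP 0%R r; last first.
  rewrite integral0_eq.
    rewrite integral0_eq// => s _; rewrite integral0_eq// => t _.
    by rewrite preimage_nnfun0// indic0 mulr0.
  by move=> z _; rewrite preimage_nnfun0// indic0 mulr0.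
under eq_integral do rewrite EFinM.
rewrite ge0_integralZl//; last by apply/measurable_EFinP.
rewrite integral_compprod_indic// -ge0_integralZl//; last 2 first.
- apply: (@measurable_kfcomp _ _ _ _ _ k (EFin \o \1_(f @^-1` [set r]))).
    by apply/measurable_EFinP.
  by move=> t /=; rewrite lee_fin.
- by move=> s _; apply: integral_ge0.
apply: eq_integral => s _.
rewrite -ge0_integralZl//.
by apply: (measurableT_comp (f := EFin \o \1_(f @^-1` [set r])));
  [exact/measurable_EFinP|exact: measurable_pair1].
Qed.

(** Disintegration: the identity holds for indicators by definition of the
    composition, and passes to nonnegative functions through simple functions
    and monotone convergence. *)
Lemma ge0_integral_compprod (f : S * T -> \bar R) :
  measurable_fun [set: S * T] f -> (forall z, 0 <= f z) ->
  \int[compprod m k]_z f z = \int[m]_s \int[k s]_t f (s, t).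
Proof.
move=> mf f0; pose f_ := nnsfun_approx measurableT mf.
have mf_ n : measurable_fun setT (EFin \o f_ n) by apply/measurable_EFinP.
have mf_s n s : measurable_fun setT (fun t => (f_ n (s, t))%:E).
  by apply: measurableT_comp (mf_ n) (measurable_pair1 s).
have f_cvg z : (f_ n z)%:E @[n --> \oo] --> f z.
  by exact: cvg_nnsfun_approx.
have f_nd z a b : (a <= b)%N -> (f_ a z)%:E <= (f_ b z)%:E.
  by move=> ab; rewrite lee_fin; exact/lefP/nd_nnsfun_approx.
transitivity (\int[compprod m k]_z limn (fun n => (f_ n z)%:E)).
  by apply/eq_integral => z _; apply/esym/cvg_lim => //; exact: f_cvg.
rewrite monotone_convergence//; last 2 first.
- by move=> n z _; rewrite lee_fin.
- by move=> z _ a b ab; exact: f_nd.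
under eq_fun do rewrite integral_compprod_nnsfun.
rewrite -monotone_convergence//; last 3 first.
- move=> n; apply: (measurable_kfcomp k (mf_ n)) => z.
  by rewrite lee_fin.
- by move=> n s _; apply: integral_ge0 => t _; rewrite lee_fin.
- move=> s _ a b ab; apply: ge0_le_integral => //.
  + by move=> t _; rewrite lee_fin.
  + by move=> t _; exact: f_nd.
apply: eq_integral => s _; rewrite -monotone_convergence//; last 2 first.
- by move=> n t _; rewrite lee_fin.
- by move=> t _ a b ab; exact: f_nd.
by apply: eq_integral => t _; apply/cvg_lim => //; exact: f_cvg.
Qed.

(** A null set [N] of the joint law has sections of [k s]-measure integrating
    to 0, hence null for almost every [s]. *)
Lemma ae_compprod (Q : S * T -> Prop) :
  {ae compprod m k, forall z, Q z} ->
  {ae m, forall s, {ae k s, forall t, Q (s, t)}}.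
Proof.
move=> [N [mN N0 QN]].
have mkN := measurable_compprod_fun k mN.
have : \int[m]_s `|k s (xsection N s)| = 0.
  by under eq_integral do rewrite gee0_abs//; exact: N0.
move/(ae_eq_integral_abs m measurableT mkN).
apply: filterS => s /(_ Logic.I) /= ks0; exists (xsection N s).
split => //; first exact: measurable_xsection.
by move=> t /= nQ; rewrite /xsection/= inE; exact: QN.
Qed.

End compprod_integral.

(** * Limits superior and integrals *)

Lemma le_limn_esup (R : realType) (u v : (\bar R)^nat) :
  (forall n, u n <= v n) -> limn_esup u <= limn_esup v.
Proof.
move=> uv; rewrite !limn_esup_lim; apply: lee_lim; try exact: is_cvg_esups.
apply: nearW => n; apply: ge_ereal_sup => _ [k nk <-].
by apply: le_trans (uv k) _; apply: ereal_sup_ubound; exists k.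
Qed.

Section dominated_limn_esup.
Context {d} {T : measurableType d} {R : realType}.
Variables (m : {measure set T -> \bar R}) (h : nat -> T -> R).
Hypothesis mh : forall n, measurable_fun [set: T] (h n).

Lemma measurable_limn_esup_EFin :
  measurable_fun [set: T] (fun x => limn_esup (fun n => (h n x)%:E)).
Proof.
by apply: measurable_fun_limn_esup => n; exact/measurable_EFinP.
Qed.

Hypothesis hoo :
  \int[m]_x ereal_sup [set `|h n x|%:E | n in [set: nat]] < +oo.

(** Reverse Fatou lemma, in the form of a convergent sequence of upper bounds of
    the integrals: [esups] decreases pointwise to the limit superior and is
    dominated by [sup_n |h_n|].  A convergent bound, unlike an inequality
    between limits superior, can be added to another convergent sequence. *)
Lemma dominated_limn_esup :
  [/\ m.-integrable [set: T] (fun x => limn_esup (fun n => (h n x)%:E)),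
      \int[m]_x esups (fun n => (h n x)%:E) n @[n --> \oo] -->
        \int[m]_x limn_esup (fun n => (h n x)%:E),
      (forall n, m.-integrable [set: T] (EFin \o h n))
    & (forall n, \int[m]_x (h n x)%:E <=
                 \int[m]_x esups (fun n => (h n x)%:E) n)].
Proof.
pose G x := ereal_sup [set `|h n x|%:E | n in [set: nat]].
have G_ge n x : `|h n x|%:E <= G x by apply: ereal_sup_ubound; exists n.
have mG : measurable_fun setT G.
  rewrite (_ : G = fun x => esups (fun n => `|h n x|%:E) 0%N).
    apply: (measurable_fun_esups (f := fun n x => `|h n x|%:E)) => n.
    by apply/measurable_EFinP; exact: measurableT_comp.
  apply/funext => x; rewrite /G /esups/= /sdrop; congr ereal_sup.
  by apply/seteqP; split => _ [n _ <-]; exists n.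
have iG : m.-integrable setT G.
  apply/integrableP; split => //.
  under eq_integral => x _.
    rewrite gee0_abs; last by apply: le_trans (G_ge 0%N x); rewrite lee_fin.
    over.
  exact: hoo.
have mf n : measurable_fun setT (fun x => esups (fun n => (h n x)%:E) n).
  by apply: measurable_fun_esups => k; exact/measurable_EFinP.
have abse_le (y z : \bar R) : - z <= y -> y <= z -> `|y| <= z.
  case: y z => [y| |] [z| |] //=; rewrite ?leNye ?leey//.
  by rewrite !lee_fin ler_norml => -> ->.
have fG x n : `|esups (fun n => (h n x)%:E) n| <= G x.
  apply: abse_le.
    apply: (@le_trans _ _ (h n x)%:E).
      apply: (@le_trans _ _ (- `|h n x|)%:E);
        last by rewrite lee_fin lerNnormlW.
      by rewrite EFinN leeN2.
    by apply: ereal_sup_ubound; exists n => /=.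
  apply: ge_ereal_sup => _ [k _ <-]; apply: le_trans (G_ge k x).
  by rewrite lee_fin ler_norm.
have cvgf x : esups (fun n => (h n x)%:E) n @[n --> \oo] -->
    limn_esup (fun n => (h n x)%:E).
  by rewrite limn_esup_lim; exact: is_cvg_esups.
have [] := @dominated_convergence _ _ _ m setT measurableT
  (fun n x => esups (fun n => (h n x)%:E) n) _ G mf
  measurable_limn_esup_EFin _ iG _.
- by apply: aeW => x _; exact: cvgf.
- by apply: aeW => x n _; exact: fG.
move=> isup _ csup.
have ih n : m.-integrable setT (EFin \o h n).
  apply: (le_integrable measurableT _ _ iG); first exact/measurable_EFinP.
  by move=> x _ /=; apply: le_trans (G_ge n x) (lee_abs _).
split => // n; apply: (le_integral measurableT (ih n)).
  apply: (le_integrable measurableT (mf n) _ iG) => x _.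
  by apply: le_trans (fG x n) (lee_abs _).
by move=> x _; apply: ereal_sup_ubound; exists n => /=.
Qed.

End dominated_limn_esup.

(** The integral of [`|g - f|] equals that of [g - f], which is nonpositive. *)
Lemma ae_eq_of_le_integral d (T : measurableType d) (R : realType)
    (m : {measure set T -> \bar R}) (f g : T -> \bar R) :
  m.-integrable [set: T] f -> m.-integrable [set: T] g ->
  {ae m, forall x, f x <= g x} -> \int[m]_x g x <= \int[m]_x f x ->
  {ae m, forall x, f x = g x}.
Proof.
move=> if_ ig fg gf.
have igf := integrableB measurableT ig if_.
have mgf := measurable_int _ igf.
have fin_f := integrable_ae measurableT if_.
have fin_g := integrable_ae measurableT ig.
have gf0 : \int[m]_x `|(g \- f) x| = 0.
  apply/eqP; rewrite eq_le integral_ge0// andbT.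
  rewrite (ae_eq_integral (g \- f))//; last 2 first.
  - exact: measurableT_comp.
  - apply: filterS3 fin_f fin_g fg => x /(_ Logic.I) ff /(_ Logic.I) gg fg _.
    by rewrite gee0_abs// sube_ge0// ff.
  by rewrite integralB// sube_le0.
move/(ae_eq_integral_abs m measurableT mgf) : gf0 => gf0.
apply: filterS3 fin_f fin_g gf0 => x /(_ Logic.I) ff /(_ Logic.I) gg.
move=> /(_ Logic.I)/= /eqP.
by rewrite sube_eq ?add0e ?fin_num_adde_defl// => /eqP.
Qed.

(** * The law of the process under a stationary policy *)

Section stationary_law.
Context {R : realType} {X : ptopologicalType} {A : pdiscreteTopologicalType}
  {d : nat} {M : mdp R X A d}.
Variables (mu : stationary_policy M) (p : probability (borel X) R).

Definition occupation : probability (borel X * borel A)%type R :=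
  compprod p mu.

Lemma ge0_integral_occupation (f : borel X * borel A -> \bar R) :
  measurable_fun [set: borel X * borel A] f -> (forall xa, 0 <= f xa) ->
  \int[occupation]_xa f xa = \int[p]_x \int[mu x]_a f (x, a).
Proof. exact: (ge0_integral_compprod p mu). Qed.

Lemma ae_occupation_adm : {ae occupation, forall xa, adm M xa.1 xa.2}.
Proof.
exists (~` [set xa | adm M xa.1 xa.2]); split => //.
  by apply: measurableC; exact: adm_measurable.
rewrite probability_setC; last exact: adm_measurable.
rewrite [X in 1 - X](_ : _ = 1) ?subee//.
rewrite /occupation /= /compprod -[RHS](@probability_setT _ _ _ p).
rewrite (eq_integral (cst 1)) ?integral_cst ?mul1e// => x _.
transitivity (mu x (adm M x)); last exact: stationary_adm.
by apply: (congr1 (mu x)); apply/seteqP; split => a; rewrite /xsection/= inE.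
Qed.

Lemma ge0_integral_occupation_fst (f : borel X -> \bar R) :
  measurable_fun [set: borel X] f -> (forall x, 0 <= f x) ->
  \int[occupation]_xa f xa.1 = \int[p]_x f x.
Proof.
move=> mf f0; rewrite (ge0_integral_occupation (f := f \o fst)); last 2 first.
- exact: measurableT_comp mf measurable_fst.
- by move=> xa; exact: f0.
apply: eq_integral => x _ /=.
by rewrite integral_cst// prob_kernel mule1.
Qed.

Lemma measurable_integral_trans (f : borel X -> \bar R) :
  measurable_fun [set: borel X] f ->
  measurable_fun [set: borel X * borel A]
    (fun xa => \int[trans M xa]_y f y).
Proof.
move=> mf; rewrite (_ : (fun _ => _) =
    (fun xa => \int[trans M xa]_y f^\+ y - \int[trans M xa]_y f^\- y)).
  apply: emeasurable_funB; apply: measurable_fun_integral_kernel => //.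
  - by move=> U mU; exact: measurable_kernel.
  - exact: measurable_funepos.
  - by move=> U mU; exact: measurable_kernel.
  - exact: measurable_funeneg.
by apply/funext => xa; rewrite integralE.
Qed.

Hypothesis inv : Defs.invariant mu p.

(** Invariance says that [p] is the law of the state reached by one transition
    from the occupation measure, so integrals against [p] can be computed
    before or after that transition. *)
Lemma ge0_integral_invariant (f : borel X -> \bar R) :
  measurable_fun [set: borel X] f -> (forall x, 0 <= f x) ->
  \int[occupation]_xa \int[trans M xa]_y f y = \int[p]_x f x.
Proof.
move=> mf f0.
have mfs : measurable_fun setT
    (f \o (snd : (borel X * borel A) * borel X -> borel X)).
  exact: measurableT_comp mf measurable_snd.
have <- := ge0_integral_compprod occupation (trans M) mfs (fun z => f0 z.2).
rewrite -(@ge0_integral_pushforward _ _ _ _ _ _ measurable_snd _ setT)//.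
apply: eq_measure_integral => B mB _.
transitivity (\int[occupation]_xa trans M xa B); last first.
  rewrite ge0_integral_occupation//; last exact: measurable_kernel.
  exact/esym/inv.
apply: eq_integral => xa _; apply: (congr1 (trans M xa)).
by apply/seteqP; split => y; rewrite /xsection/= inE.
Qed.

(** The positive and negative parts both have finite integrals, so the
    nonnegative case applies to each and the difference is meaningful. *)
Lemma integral_invariant (f : borel X -> \bar R) :
  p.-integrable [set: borel X] f ->
  occupation.-integrable [set: borel X * borel A]
    (fun xa => \int[trans M xa]_y f y) /\
  \int[occupation]_xa \int[trans M xa]_y f y = \int[p]_x f x.
Proof.
move=> intf; have mf := measurable_int _ intf.
have intg (g : borel X -> \bar R) : p.-integrable [set: borel X] g ->
    (forall x, 0 <= g x) ->
    occupation.-integrable [set: borel X * borel A]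
      (fun xa => \int[trans M xa]_y g y).
  move=> ig g0; apply/integrableP; split.
    by apply: measurable_integral_trans; exact: measurable_int ig.
  under eq_integral do rewrite gee0_abs ?integral_ge0//.
  rewrite ge0_integral_invariant//; last exact: measurable_int ig.
  exact: integrable_lty ig.
have ip := intg _ (integrable_funepos measurableT intf) (funepos_ge0 f).
have in_ := intg _ (integrable_funeneg measurableT intf) (funeneg_ge0 f).
have KE : (fun xa => \int[trans M xa]_y f y) =
    (fun xa => \int[trans M xa]_y f^\+ y) \-
    (fun xa => \int[trans M xa]_y f^\- y).
  by apply/funext => xa; rewrite integralE.
split; first by rewrite KE; exact: integrableB.
rewrite KE integralB// !ge0_integral_invariant//.
- by rewrite -integralE.
- exact: measurable_funeneg.
- exact: measurable_funepos.
Qed.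

Lemma integral_occupation_fst (f : borel X -> \bar R) :
  p.-integrable [set: borel X] f ->
  occupation.-integrable [set: borel X * borel A] (f \o fst) /\
  \int[occupation]_xa f xa.1 = \int[p]_x f x.
Proof.
move=> intf; have mf := measurable_int _ intf.
have mf1 : measurable_fun [set: borel X * borel A] (f \o fst).
  exact: measurableT_comp mf measurable_fst.
split.
  apply/integrableP; split => //=.
  rewrite (ge0_integral_occupation_fst (f := abse \o f)).
  - by case/integrableP : intf.
  - exact: measurableT_comp.
  - by move=> x; exact: abse_ge0.
rewrite -[LHS]/(\int[occupation]_xa (f \o fst) xa) integralE [RHS]integralE.
rewrite funepos_comp funeneg_comp /=; congr (_ - _).
  by apply: ge0_integral_occupation_fst => //; exact: measurable_funepos.
by apply: ge0_integral_occupation_fst => //; exact: measurable_funeneg.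
Qed.

Local Notation Law := (law (policy_of_stationary mu) p).

(** Under the stationary policy the action at time [n] depends on the history
    only through its last state. *)
Lemma integral_law_action n (f : borel X * borel A -> \bar R) :
  measurable_fun [set: borel X * borel A] f -> (forall xa, 0 <= f xa) ->
  \int[compprod (Law n) (policy_of_stationary mu n)]_ha
     f (hist_state ha.1, ha.2) =
  \int[Law n]_h \int[mu (hist_state h)]_a f (hist_state h, a).
Proof.
move=> mf f0.
by rewrite (ge0_integral_compprod _ _
  (measurableT_comp mf (@measurable_hist_state_action X A n)) (fun=> f0 _)).
Qed.

Lemma measurable_integral_policy (f : borel X * borel A -> \bar R) :
  measurable_fun [set: borel X * borel A] f -> (forall xa, 0 <= f xa) ->
  measurable_fun [set: borel X] (fun x => \int[mu x]_a f (x, a)).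
Proof. by move=> mf f0; exact: (measurable_kfcomp mu mf f0). Qed.

(** By invariance the state at every time has law [p]. *)
Lemma integral_law_state n (f : borel X -> \bar R) :
  measurable_fun [set: borel X] f -> (forall x, 0 <= f x) ->
  \int[Law n]_h f (hist_state h) = \int[p]_x f x.
Proof.
elim: n f => [//|n IH] f mf f0 /=.
rewrite (ge0_integral_compprod _ _ (measurableT_comp mf measurable_snd)
  (fun=> f0 _)) /=.
pose g xa := \int[trans M xa]_y f y.
have mg : measurable_fun setT g by exact: measurable_integral_trans.
have g0 xa : 0 <= g xa by exact: integral_ge0.
rewrite [LHS](integral_law_action n mg g0).
rewrite (IH _ (measurable_integral_policy mg g0)); last first.
  by move=> x; exact: integral_ge0.
by rewrite -ge0_integral_occupation// ge0_integral_invariant.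
Qed.

Lemma measurable_total_cost (c : X * A -> \bar R) n :
  measurable_fun [set: borel X * borel A] c ->
  measurable_fun [set: hist X A n] (@total_cost X A R c n).
Proof.
move=> mc; elim: n => [|n IH] /=; first exact: measurable_cst.
apply: emeasurable_funD.
  apply: measurableT_comp IH _.
  exact: measurableT_comp measurable_fst measurable_fst.
apply: (measurableT_comp mc).
apply: (measurableT_comp (@measurable_hist_state_action X A n)).
exact: measurable_fst.
Qed.

(** Each of the [n] stages contributes the same expected cost, the
    occupation integral. *)
Lemma integral_law_total_cost (c : X * A -> \bar R) n :
  measurable_fun [set: borel X * borel A] c -> (forall xa, 0 <= c xa) ->
  \int[Law n]_h total_cost c h = n%:R%:E * \int[occupation]_xa c xa.
Proof.
move=> mc c0.
have mt k : measurable_fun [set: hist X A k] (@total_cost X A R c k).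
  exact: measurable_total_cost.
have t0 k (h : hist X A k) : 0 <= total_cost c h.
  by elim: k h => [//|k IH] h /=; exact: adde_ge0.
have mca k := measurableT_comp mc (@measurable_hist_state_action X A k).
elim: n => [|n IH] /=; first by rewrite integral0 mul0e.
rewrite (ge0_integral_compprod _ _ (mt n.+1) (t0 n.+1)) /=.
under eq_integral => ha _ do rewrite integral_cst// prob_kernel mule1.
rewrite ge0_integralD//; last first.
  exact: (measurableT_comp (mt n) (@measurable_fst _ _ (hist X A n) (borel A))).
rewrite (ge0_integral_compprod _ _ (measurableT_comp (mt n) measurable_fst)
  (fun=> t0 n _)) /=.
under eq_integral => h _ do rewrite integral_cst// prob_kernel mule1.
rewrite [X in X + _]IH integral_law_action//.
rewrite (integral_law_state n (measurable_integral_policy mc c0)); last first.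
  by move=> x; exact: integral_ge0.
rewrite -ge0_integral_occupation// -[n.+1]addn1 natrD EFinD.
by rewrite ge0_muleDl ?mul1e ?lee_fin// ler0n.
Qed.

(** The Cesaro means are constant from [n = 1] on. *)
Lemma avg_cost_stationary i :
  avg_cost i (policy_of_stationary mu) p = \int[occupation]_xa cost M i xa.
Proof.
rewrite /avg_cost; apply: (cvg_limn_einf_sup _).2.
apply: cvg_near_cst; near=> n.
rewrite integral_law_total_cost; last 2 first.
- exact: cost_measurable.
- exact: cost_ge0.
rewrite muleA -EFinM mulVf ?mul1e// pnatr_eq0 -lt0n.
by near: n; exists 1%N.
Unshelve. all: by end_near. Qed.

End stationary_law.

(** * The limit of the dual inequalities *)

Section discrete_borel.
Context {A : pdiscreteTopologicalType}.

(** Every set is open in a discrete space, so nothing has to be checked about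
    dependence on the action alone. *)
Lemma measurable_discrete (B : set (borel A)) : measurable B.
Proof. by apply: sub_sigma_algebra; exact: discrete_open. Qed.

Lemma measurable_fun_discrete d (T : measurableType d) D (f : borel A -> T) :
  measurable_fun D f.
Proof. by move=> _ Y _; exact: measurable_discrete. Qed.

End discrete_borel.

Section dual_sequence.
Context {R : realType} {X : ptopologicalType} {A : pdiscreteTopologicalType}
  {d : nat} {M : mdp R X A d}.
Variables (rho : nat -> R) (h : nat -> X -> R) (beta : nat -> 'rV[R]_d)
  (betas : 'rV[R]_d).
Hypothesis max_seq : maximizing_sequence M rho h beta.
Hypothesis beta_cvg : beta n @[n --> \oo] --> betas.

Let beta_coord i : (beta n 0 i)%R @[n --> \oo] --> (betas 0 i)%R.
Proof.
exact: (@cvg_comp _ _ _ beta (fun b : 'rV[R]_d => b 0%R i) _ _ _ beta_cvg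
  (@coord_continuous R 1 d 0%R i betas)).
Qed.

Lemma limit_multiplier_le0 i : (betas 0 i <= 0)%R.
Proof.
apply: (cvgr_to_le (@beta_coord i)).
by apply: nearW => n; have [feas _ _] := max_seq; have [_ _ _] := feas n.
Qed.

Lemma cvg_multiplier_sum (v : 'I_d -> R) :
  (\sum_(i < d) beta n 0 i * v i)%R @[n --> \oo] -->
  (\sum_(i < d) betas 0 i * v i)%R.
Proof.
apply: cvg_big => [|i _]; first exact: add_continuous.
by apply: cvgMl; exact: beta_coord.
Qed.

(** The dual objective [rho_n + sum_i beta_n,i kappa_i] converges to [rho_c],
    and its second part converges with [beta_n].  [rho_c] is finite because it
    is bounded below by the first, real, dual objective. *)
Lemma cvg_dual_rho : dual_value M = rho_c M -> rho_c M < +oo ->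
  rho_c M \is a fin_num /\ (rho n)%:E @[n --> \oo] --> lagrangian_value M betas.
Proof.
move=> dual_rho rho_oo; have [feas _ obj_cvg] := max_seq.
have rho_fin : rho_c M \is a fin_num.
  rewrite fin_real// rho_oo andbT -dual_rho.
  apply: lt_le_trans (ltNyr (dual_obj M (rho 0%N) (beta 0%N))) _.
  by apply: ereal_sup_ubound; exists (rho 0%N), (h 0%N), (beta 0%N).
split => //.
rewrite (_ : (fun n => (rho n)%:E) = (fun n =>
    (dual_obj M (rho n) (beta n))%:E -
    (\sum_(i < d) beta n 0 i * kappa M 0 i)%R%:E)); last first.
  by apply/funext => n; rewrite -EFinB /dual_obj addrK.
apply: cvgeB.
- by rewrite fin_num_adde_defl.
- by rewrite -dual_rho.
- by apply: cvg_EFin; [exact: nearW|exact: cvg_multiplier_sum].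
Qed.

(** Dual feasibility gives [h_n x <= u_n] for a sequence [u_n] whose limit is
    finite, so that the limit superior of [h_n x] is bounded by that limit. *)
Lemma optimality_inequality x a : adm M x a ->
  dual_value M = rho_c M -> rho_c M < +oo ->
  \int[trans M (x, a)]_y ereal_sup [set `|h n y|%:E | n in [set: nat]] < +oo ->
  lagrangian_value M betas + limsup_fun h x <=
    lagrangian_cost M betas (x, a) + \int[trans M (x, a)]_y limsup_fun h y
  /\ limsup_fun h x < +oo.
Proof.
move=> adm_xa dual_rho rho_oo h_oo; have [feas _ _] := max_seq.
have [rho_fin rho_cvg] := cvg_dual_rho dual_rho rho_oo.
have mh n : measurable_fun [set: borel X] (h n) by have [] := feas n.
have [isup csup ih hle] := dominated_limn_esup mh h_oo.
have Ifin : \int[trans M (x, a)]_y limsup_fun h y \is a fin_num.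
  by have := integrable_fin_num measurableT isup.
have cfin i : cost M i (x, a) \is a fin_num.
  by rewrite ge0_fin_numE ?cost_ge0// cost_fin.
pose v i := fine (ccost M i (x, a)).
have lagE (b : 'rV[R]_d) : \sum_(i < d) (b 0 i)%:E * ccost M i (x, a) =
    (\sum_(i < d) b 0 i * v i)%R%:E.
  by rewrite -sumEFin; apply: eq_bigr => i _; rewrite EFinM fineK// cfin.
have lval_fin : lagrangian_value M betas \is a fin_num.
  by rewrite fin_numB rho_fin.
(* The integral of [h_n] is replaced by that of [esups], which converges. *)
pose u n := cost M ord0 (x, a) - (\sum_(i < d) beta n 0 i * v i)%R%:E -
  (rho n)%:E + \int[trans M (x, a)]_y esups (fun n => (h n y)%:E) n.
have h_le_u n : (h n x)%:E <= u n.
  have [_ _ /(_ (x, a) adm_xa) + _] := feas n.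
  have Infin := integrable_fin_num measurableT (ih n).
  move: (hle n) Infin; rewrite /u /= lagE -(fineK (cfin ord0)).
  case: (\int[trans M (x, a)]_y (h n y)%:E) => [In| |]//.
  case: (\int[trans M (x, a)]_y esups _ n) => [En| |]//=; last by rewrite !leey.
  rewrite -!EFinB -!EFinD !lee_fin => IE _ hI.
  by lra.
have u_cvg : u n @[n --> \oo] --> lagrangian_cost M betas (x, a) -
    lagrangian_value M betas + \int[trans M (x, a)]_y limsup_fun h y.
  apply: cvgeD => //; first exact: fin_num_adde_defl.
  apply: cvgeB => //; first by rewrite fin_num_adde_defl ?fin_numN.
  apply: cvgeB.
  - by rewrite fin_num_adde_defr// cfin.
  - exact: cvg_cst.
  - rewrite lagE; apply: cvg_EFin; [exact: nearW|exact: cvg_multiplier_sum].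
have hsup : limsup_fun h x <= lagrangian_cost M betas (x, a) -
    lagrangian_value M betas + \int[trans M (x, a)]_y limsup_fun h y.
  rewrite -(cvg_limn_einf_sup u_cvg).2; exact: le_limn_esup.
have lcost_fin : lagrangian_cost M betas (x, a) \is a fin_num.
  by rewrite /lagrangian_cost lagE fin_numB cfin.
move: hsup; rewrite -(fineK lcost_fin) -(fineK lval_fin) -(fineK Ifin).
rewrite -EFinB -EFinD; case: (limsup_fun h x) => [hx| |] //=; last first.
  by move=> _; split; rewrite ?leNye ?ltNyr.
by rewrite -!EFinD !lee_fin => hx_le; split; [lra|exact: ltry].
Qed.

End dual_sequence.

(** * Complementary slackness *)

Section complementary_slackness.
Context {R : realType} {X : ptopologicalType} {A : pdiscreteTopologicalType}
  {d : nat} {M : mdp R X A d}.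
Variables (mu : stationary_policy M) (p : probability (borel X) R).

Local Notation P := (occupation mu p).

Lemma integrable_cost i : \int[P]_xa cost M i xa < +oo ->
  P.-integrable [set: borel X * borel A] (cost M i).
Proof.
move=> coo; apply/integrableP; split; first exact: cost_measurable.
by under eq_integral do rewrite gee0_abs ?cost_ge0//.
Qed.

Hypothesis inv : Defs.invariant mu p.
Hypothesis feas : mdp_feasible (policy_of_stationary mu) p.

Let integrable_cost0 : P.-integrable [set: borel X * borel A] (cost M ord0).
Proof.
by apply: integrable_cost; rewrite -avg_cost_stationary//; case: feas.
Qed.

Let integrable_ccost i :
  P.-integrable [set: borel X * borel A] (@ccost _ _ _ _ M i).
Proof.
apply: integrable_cost; rewrite -avg_cost_stationary//.
by apply: le_lt_trans (ltry (kappa M 0 i)%R); case: feas.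
Qed.

Lemma integrable_lagrangian_cost (b : 'rV[R]_d) :
  P.-integrable [set: borel X * borel A] (lagrangian_cost M b).
Proof.
apply: integrableB => //; apply: integrable_sum => // i _.
exact: integrableZl.
Qed.

(** Weak duality for the multipliers: [- b_i] is nonnegative and the [i]-th
    average cost, an occupation integral, is at most [kappa_i]. *)
Lemma integral_lagrangian_cost_le (b : 'rV[R]_d) :
  (forall i, (b 0 i <= 0)%R) ->
  \int[P]_xa lagrangian_cost M b xa <=
  avg_cost ord0 (policy_of_stationary mu) p -
    (\sum_(i < d) b 0 i * kappa M 0 i)%R%:E.
Proof.
move=> b0; have int_b i : P.-integrable [set: borel X * borel A]
    (fun xa => (b 0 i)%R%:E * ccost M i xa) by exact: integrableZl.
rewrite integralB//; last by apply: integrable_sum.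
rewrite avg_cost_stationary// leeD2l// leeN2 integral_sum// -sumEFin.
apply: lee_sum => i _; rewrite integralZl// EFinM.
rewrite -leeN2 -!mulNe lee_wpmul2l ?oppe_ge0 ?lee_fin//.
by rewrite -avg_cost_stationary//; case: feas.
Qed.

(** Complementary slackness: by invariance [g] contributes the same finite
    amount to the occupation integrals of both sides, so the bound on the
    Lagrangian cost orders these integrals opposite to the pointwise
    inequality. *)
Lemma ae_occupation_optimality (b : 'rV[R]_d) (r : R)
    (g : borel X -> \bar R) : (forall i, (b 0 i <= 0)%R) ->
  avg_cost ord0 (policy_of_stationary mu) p -
    (\sum_(i < d) b 0 i * kappa M 0 i)%R%:E <= r%:E ->
  p.-integrable [set: borel X] g ->
  (forall x a, adm M x a -> r%:E + g x <=
    lagrangian_cost M b (x, a) + \int[trans M (x, a)]_y g y) ->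
  {ae P, forall xa, r%:E + g xa.1 =
    lagrangian_cost M b xa + \int[trans M xa]_y g y}.
Proof.
move=> b0 costr intg ineq.
have [intg1 g1E] := integral_occupation_fst mu intg.
have [intK KE] := integral_invariant inv intg.
have intr : P.-integrable [set: borel X * borel A] (cst r%:E).
  exact: (finite_measure_integrable_cst P r).
have intL := integrable_lagrangian_cost b.
apply: ae_eq_of_le_integral.
- exact: (integrableD measurableT intr intg1).
- exact: (integrableD measurableT intL intK).
- apply: (@filterS _ _ (ae_filter_ringOfSetsType P) _ _ _
    (ae_occupation_adm mu p)) => -[x a] /=; exact: ineq.
have rE : \int[P]_xa cst r%:E xa = r%:E.
  by rewrite integral_cst// [X in _ * X](@probability_setT _ _ _ P) mule1.
rewrite integralD// [X in _ <= X]integralD// KE.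
rewrite [X in _ <= X + _]rE [X in _ <= _ + X]g1E leeD2r//.
exact: le_trans (integral_lagrangian_cost_le b0) costr.
Qed.

End complementary_slackness.

Unset Implicit Arguments.
Set Strict Implicit.

Theorem proposition4p2 (R : realType) (X : ptopologicalType)
  (A : pdiscreteTopologicalType) (d : nat) (M : mdp R X A d)
  (rho : nat -> R) (h : nat -> X -> R) (beta : nat -> 'rV[R]_d)
  (mu : stationary_policy M) (p : probability (borel X) R)
  (betas : 'rV[R]_d) :
  borel_space R X ->
  countable [set: A] ->
  maximizing_sequence M rho h beta ->
  stationary_optimal_pair mu p ->
  primal_value M = dual_value M ->
  dual_value M = rho_c M ->
  rho_c M < +oo ->
  \int[p]_(x in [set: borel X]) `|limsup_fun h x| < +oo ->
  (forall (x : X) (a : A), adm M x a ->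
     \int[trans M (x, a)]_(y in [set: borel X])
       ereal_sup [set `|h n y|%:E | n in [set: nat]] < +oo) ->
  beta n @[n --> \oo] --> betas ->
  [/\ (forall x : X, limsup_fun h x < +oo),
      {ae p, forall x, limsup_fun h x \is a fin_num} /\
      (forall (x : X) (a : A), adm M x a ->
         {ae trans M (x, a), forall y, limsup_fun h y \is a fin_num}),
      (forall (x : X) (a : A), adm M x a ->
         lagrangian_value M betas + limsup_fun h x
         <= lagrangian_cost M betas (x, a)
            + \int[trans M (x, a)]_y limsup_fun h y)
    & {ae p, forall x : borel X,
         lagrangian_value M betas + limsup_fun h x
         = ereal_inf [set lagrangian_cost M betas (x, a)
                          + \int[trans M (x, a)]_y limsup_fun h y
                     | a in adm M x] /\
         lagrangian_value M betas + limsup_fun h x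
         = \int[mu x]_(a in (adm M x : set (borel A)))
             (lagrangian_cost M betas (x, a)
              + \int[trans M (x, a)]_y limsup_fun h y)}].
Proof.
move=> _ _ max_seq [feas opt inv] _ dual_rho rho_oo h_p h_q beta_cvg.
have [rho_fin _] := cvg_dual_rho max_seq beta_cvg dual_rho rho_oo.
have [hfeas _ _] := max_seq.
have mh n : measurable_fun [set: borel X] (h n) by have [] := hfeas n.
have ineq x a : adm M x a -> _ := fun ax =>
  optimality_inequality max_seq beta_cvg ax dual_rho rho_oo (h_q x a ax).
have lval_fin : lagrangian_value M betas \is a fin_num.
  by rewrite fin_numB rho_fin.
have int_h : p.-integrable [set: borel X] (limsup_fun h).
  by apply/integrableP; split => //; exact: measurable_limn_esup_EFin.
have int_hq x a : adm M x a ->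
    (trans M (x, a)).-integrable [set: borel X] (limsup_fun h).
  by move=> /h_q hq; have [] := dominated_limn_esup mh hq.
split.
- by move=> x; have [a /ineq[]] := adm_nonempty M x.
- split.
    by apply: filterS (integrable_ae measurableT int_h) => x /(_ Logic.I).
  move=> x a /int_hq int_ha.
  by apply: filterS (integrable_ae measurableT int_ha) => y /(_ Logic.I).
- by move=> x a /ineq[].
have ae_eq_occ : {ae occupation mu p, forall xa,
    lagrangian_value M betas + limsup_fun h xa.1 =
    lagrangian_cost M betas xa + \int[trans M xa]_y limsup_fun h y}.
  rewrite -(fineK lval_fin); apply: ae_occupation_optimality => //.
  - exact: limit_multiplier_le0 max_seq beta_cvg.
  - by rewrite fineK// opt.
  - by move=> x a /ineq[]; rewrite fineK.
have := ae_compprod (@filterI _ _ (ae_filter_ringOfSetsType (occupation mu p))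
  _ _ (ae_occupation_adm mu p) ae_eq_occ).
apply: filterS => x ae_a.
(* A probability does not concentrate on an empty set, so an admissible action
   with equality exists. *)
have [a [ax eq_a]] : exists a, adm M x a /\
    lagrangian_value M betas + limsup_fun h x =
    lagrangian_cost M betas (x, a) + \int[trans M (x, a)]_y limsup_fun h y.
  apply: contrapT => /forallNP none; have [N [mN N0 subN]] := ae_a.
  have /eqP : mu x setT = 0.
    by apply: subset_measure0 N0 => // a _; apply: subN; exact: none.
  by rewrite prob_kernel onee_eq0.
split.
  apply/eqP; rewrite eq_le; apply/andP; split.
    by apply: le_ereal_inf_tmp => _ [a' /ineq[le_a' _] <-].
  by apply: ereal_inf_lbound; exists a.
have mx : measurable (adm M x : set (borel A)) by exact: measurable_discrete.
rewrite (ae_eq_integral (cst (lagrangian_value M betas + limsup_fun h x)))//.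
- by rewrite integral_cst// stationary_adm mule1.
- exact: measurable_fun_discrete.
- by apply: filterS ae_a => a' [_ ->].
Qed.
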